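(* Let $M$ be a real symmetric positive semi-definite $n\times n$ matrix with constant diagonal $\operatorname{diag} M=\lambda\mathbf 1$, and suppose that the ellipsoid $\mathcal E=\{x\in\mathbb R^n: x^\top M x=n\}$ is locally extremal (in the sense defined in the context). If $M$ is not singular, then $\lambda\leq 1$, and equality $\lambda=1$ holds only if $\mathcal E$ is the Euclidean sphere of radius $\sqrt n$ centred at the origin (equivalently, $M=I_n$).
   Context: $\mathbf 1=(1,\dots,1)\in\mathbb R^n$. Let $\mathcal H=\{x\in\mathbb R^n: |\prod_{i=1}^n x_i|=1\}$; its branches are its $2^n$ connected components, one in each open orthant of $\mathbb R^n$. For a real symmetric positive semi-definite matrix $M$, the set $\{x: x^\top M x=n\}$ is called an ellipsoid (possibly unbounded if $M$ is singular). Call an ellipsoid admissible if it is given by a real symmetric positive semi-definite matrix $M$ all of whose diagonal entries are equal to a common value, and it meets every branch of $\mathcal H$. The ellipsoid $\mathcal E$ given by $M$ with $\operatorname{diag} M=\lambda\mathbf 1$ is called locally extremal if it is admissible and, for any admissible ellipsoid in a sufficiently small neighbourhood of $\mathcal E$ (i.e. with matrix in a sufficiently small neighbourhood of $M$), the common diagonal entry of its matrix is at most $\lambda$. *)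

(* Defs.v *)
From HB Require Import structures.
From mathcomp Require Import all_boot all_order all_algebra.
From mathcomp Require Import all_classical all_reals all_analysis.

Set Implicit Arguments.
Unset Strict Implicit.
Unset Printing Implicit Defensive.

Import Order.TTheory GRing.Theory Num.Theory.
Import numFieldNormedType.Exports.

Local Open Scope classical_set_scope.
Local Open Scope ring_scope.

Definition hyperbola (R : realType) (n : nat) : set 'cV[R]_n :=
  [set x : 'cV[R]_n | `|\prod_i x i 0| = 1].
Arguments hyperbola : clear implicits.

Definition branches (R : realType) (n : nat) : set (set 'cV[R]_n) :=
  [set connected_component (hyperbola R n) x | x in hyperbola R n].
Arguments branches : clear implicits.

Definition psd (R : realType) (n : nat) (M : 'M[R]_n) : Prop :=
  M \is symmetricmx /\ forall x : 'cV[R]_n, 0 <= (x^T *m M *m x) 0 0.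

Definition const_diag (R : realType) (n : nat) (M : 'M[R]_n) (lambda : R) : Prop :=
  forall i, M i i = lambda.

Definition ellipsoid (R : realType) (n : nat) (M : 'M[R]_n) : set 'cV[R]_n :=
  [set x : 'cV[R]_n | (x^T *m M *m x) 0 0 = n%:R].

(* Admissibility is a predicate on matrices: for n > 0 an ellipsoid that meets
   the branches is nonempty, hence determines its semi-definite matrix. *)
Definition admissible (R : realType) (n : nat) (M : 'M[R]_n) : Prop :=
  [/\ psd M,
      exists lambda, const_diag M lambda &
      forall B, branches R n B -> ellipsoid M `&` B !=set0].

Definition locally_extremal (R : realType) (n : nat) (M : 'M[R]_n)
    (lambda : R) : Prop :=
  [/\ const_diag M lambda, admissible M &
      \forall N \near M, admissible N ->
        forall mu, const_diag N mu -> mu <= lambda].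

(* The canonical norm on 'cV[R]_n is the sup norm, so the Euclidean norm is
   written out. *)
Definition euclidean_sphere (R : realType) (n : nat) (r : R) : set 'cV[R]_n :=
  [set x : 'cV[R]_n | Num.sqrt (\sum_i x i 0 ^+ 2) = r].
Arguments euclidean_sphere {R} n r.

(* Main.v *)
Require Import Defs.
From mathcomp Require Import all_boot all_order all_algebra.
From mathcomp Require Import all_classical all_reals all_analysis.
From mathcomp Require Import ring lra.

Set Implicit Arguments.
Unset Strict Implicit.
Unset Printing Implicit Defensive.

Import Order.TTheory GRing.Theory Num.Theory.
Import numFieldNormedType.Exports.

Local Open Scope classical_set_scope.
Local Open Scope ring_scope.

(** Write [q_M x] for [x^T M x], and suppose that [n] is at least 2.  Since [M] is
    positive definite, [q_M] attains its minimum on each of the finitely many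
    branches, at some point [x_s], and [q_M x_s <= n] because the ellipsoid meets
    the branch.  Conversely [q_M] takes arbitrarily large values on a branch, so
    by connectedness the ellipsoid meets a branch as soon as [q_M] takes a value
    at most [n] there ([ellipsoid_meets]).

    Call a branch active if [q_M x_s = n].  Moving along the hyperbola, by
    multiplying one coordinate and dividing another by the same factor, shows
    that the products [(x_s)_i (M x_s)_i] are all equal
    ([branch_min_stationary]); on an active branch they sum to [n], so each of
    them is 1.

    If a symmetric [N] with constant positive diagonal had [q_N x_s < 0] on all
    active branches, then [M + t N] would be admissible for small [t > 0], with a
    larger diagonal ([no_improving_direction]).  As the diagonal part of [N] may
    be taken arbitrarily small, this also forbids such an [N] with zero diagonal.
    By Gordan's alternative there are weights [w_s >= 0] of sum 1 on the active
    branches such that [D = sum_s w_s x_s x_s^T] is diagonal.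

    The [i]-th diagonal entry of [M D = sum_s w_s (M x_s) x_s^T] is
    [lambda D_ii] on the one hand, and [sum_s w_s = 1] on the other, so
    [tr D = n / lambda].  But [tr D = sum_s w_s |x_s|^2 >= n] by the inequality
    of arithmetic and geometric means on the hyperbola, whence [lambda <= 1].  In
    the case of equality all [x_s] of positive weight have coordinates 1 or -1,
    so that [M x_s = x_s] and [M = M D = D = 1]
    ([diag_le1_of_weights]).

    For [n = 1] the hyperbola is {1, -1} and admissibility alone gives
    [M = 1]. *)

(** * Quadratic forms *)

Definition qform (R : realType) n (M : 'M[R]_n) (x : 'cV[R]_n) : R :=
  (x^T *m M *m x) 0 0.

Lemma qformE (R : realType) n (M : 'M[R]_n) x :
  qform M x = \sum_i \sum_j x i 0 * M i j * x j 0.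
Proof.
rewrite /qform mxE exchange_big /=; apply: eq_bigr => j _.
by rewrite mxE mulr_suml; apply: eq_bigr => i _; rewrite mxE.
Qed.

Lemma qform_vec (R : realType) n (M : 'M[R]_n) x :
  qform M x = \sum_i x i 0 * (M *m x) i 0.
Proof.
by rewrite /qform -mulmxA mxE; apply: eq_bigr => i _; rewrite mxE.
Qed.

Lemma qformDZ (R : realType) n (M N : 'M[R]_n) t x :
  qform (M + t *: N) x = qform M x + t * qform N x.
Proof. by rewrite /qform mulmxDr mulmxDl -scalemxAr -scalemxAl !mxE. Qed.

Lemma qform1 (R : realType) n (x : 'cV[R]_n) : qform 1%:M x = \sum_i x i 0 ^+ 2.
Proof. by rewrite qform_vec mul1mx. Qed.

Lemma qform_trmx (R : realType) n (M : 'M[R]_n) x : qform M^T x = qform M x.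
Proof.
rewrite !qformE exchange_big/=; apply: eq_bigr => i _; apply: eq_bigr => j _.
by rewrite mxE; ring.
Qed.

Lemma symmetric_trmx (R : realType) n (M : 'M[R]_n) :
  (M \is symmetricmx) = (M == M^T).
Proof. by rewrite is_hermitianmxE expr0 scale1r (map_mx_id (f := idfun)). Qed.

Lemma qformD (R : realType) n (M : 'M[R]_n) x v : M \is symmetricmx ->
  qform M (x + v) = qform M x + 2 * (v^T *m (M *m x)) 0 0 + qform M v.
Proof.
rewrite symmetric_trmx => /eqP sM.
have xMv : (x^T *m (M *m v)) 0 0 = (v^T *m (M *m x)) 0 0.
  transitivity ((x^T *m (M *m v))^T 0 0); first by rewrite [RHS]mxE.
  by rewrite !trmx_mul trmxK -sM -mulmxA.
rewrite /qform (_ : (x + v)^T = x^T + v^T); last first.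
  by apply/matrixP => i j; rewrite !mxE.
rewrite 2!mulmxDl !mulmxDr -!mulmxA.
have mxD (A B : 'M[R]_1) : (A + B) 0 0 = A 0 0 + B 0 0 by rewrite mxE.
rewrite !mxD xMv; ring.
Qed.

Lemma qformZ (R : realType) n (M : 'M[R]_n) s x :
  qform M (s *: x) = s ^+ 2 * qform M x.
Proof.
rewrite !qformE mulr_sumr; apply: eq_bigr => i _.
by rewrite mulr_sumr; apply: eq_bigr => j _; rewrite !mxE; ring.
Qed.

Lemma qform_bound (R : realType) n (N : 'M[R]_n) (x : 'cV[R]_n) D :
  (forall i, x i 0 ^+ 2 <= D) ->
  `|qform N x| <= (\sum_i \sum_j `|N i j|) * D.
Proof.
move=> xD; rewrite qformE mulr_suml (le_trans (ler_norm_sum _ _ _))//.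
apply: ler_sum => i _; rewrite mulr_suml (le_trans (ler_norm_sum _ _ _))//.
apply: ler_sum => j _; rewrite mulrAC mulrC normrM ler_wpM2l//.
have := xD i; have := xD j.
by rewrite ler_norml; move=> ? ?; apply/andP; split; nra.
Qed.

(** Positive definiteness with an explicit constant [K]; the quantitative form bounds the sublevel sets of the quadratic form, so it
    yields both their compactness and the stability under perturbations. *)
Definition coercive (R : realType) n (K : R) (M : 'M[R]_n) :=
  forall (x : 'cV[R]_n) i, x i 0 ^+ 2 <= K * qform M x.

(** Cauchy-Schwarz for the form of [M], applied to [x] and the solution [y] of
    [M y = e_i], for which [x^T M y = x_i] and [y^T M y = (M^-1)_ii]. *)
Lemma psd_coercive (R : realType) n (M : 'M[R]_n) : psd M -> M \in unitmx ->
  exists2 K : R, 0 < K & coercive K M.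
Proof.
move=> [sM pM] uM.
pose L i := invmx M i i.
(* The summand 1 makes the constant positive without knowing that L i is. *)
exists (1 + \sum_i `|L i|); first by rewrite ltr_pwDl// sumr_ge0.
move=> x i.
set K := 1 + _.
have LK : L i <= K - 1.
  rewrite /K addrC addKr (bigD1 i)//= (le_trans (ler_norm _))// lerDl.
  by rewrite sumr_ge0.
have K1 : 1 <= K by rewrite lerDl sumr_ge0.
have K0 : K != 0 by rewrite gt_eqF// (lt_le_trans _ K1).
pose y := invmx M *m (delta_mx i 0 : 'cV[R]_n).
have My : M *m y = delta_mx i 0 by rewrite mulKVmx.
have q s : qform M (x + s *: y) = qform M x + 2 * (s * x i 0) + s ^+ 2 * L i.
  rewrite qformD// qformZ; congr (_ + 2 * _ + _ * _).
    rewrite (_ : (s *: y)^T = s *: y^T); last first.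
      by apply/matrixP => k l; rewrite !mxE.
    rewrite -scalemxAl mxE mulmxA.
    have -> : y^T *m M = (delta_mx i 0)^T.
      by rewrite -My [RHS]trmx_mul; congr (_ *m _); apply/eqP; rewrite -symmetric_trmx.
    by rewrite trmx_delta -rowE mxE.
  by rewrite /qform -mulmxA My -colE 2!mxE /y -colE mxE.
(* Nonnegativity of the form on the line through x in direction y, near its
   minimum on that line. *)
have := pM (x + (- x i 0 / K) *: y); rewrite -/(qform _ _) q => h.
have {}h : 0 <= K * (qform M x + 2 * (- x i 0 / K * x i 0) +
    (- x i 0 / K) ^+ 2 * L i) by rewrite mulr_ge0// ltW// (lt_le_trans _ K1).
rewrite -subr_ge0; apply: le_trans h _.
have -> : K * (qform M x + 2 * (- x i 0 / K * x i 0) +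
    (- x i 0 / K) ^+ 2 * L i) =
  K * qform M x - 2 * x i 0 ^+ 2 + x i 0 ^+ 2 * (L i / K) by field.
suff : L i / K <= 1 by move=> ?; nra.
rewrite ler_pdivrMr ?(lt_le_trans _ K1)// mul1r; lra.
Qed.

(** * Limits and compactness *)

Lemma near0_mul_lt (R : realType) (a b : R) : 0 < b ->
  \forall e \near 0^'+, e * a < b.
Proof.
move=> b0; have [a0|a0] := leP a 0.
  by near=> e; apply: le_lt_trans b0; rewrite mulr_ge0_le0.
near=> e; rewrite -ltr_pdivlMr//; near: e; apply: nbhs_right_lt.
by rewrite divr_gt0.
Unshelve. all: by end_near. Qed.

(** First-order optimality: a minimum gives [0 <= t a + t^2 b] for small [t]. *)
Lemma ge0_of_perturbed (R : realType) (a b : R) :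
  (forall t, 0 < t <= 1 -> 0 <= a + t * b) -> 0 <= a.
Proof.
move=> h; rewrite leNgt; apply/negP => a0.
near (0 : R)^'+ => t.
have /h : 0 < t <= 1 by apply/andP; split => //; near: t; exact: nbhs_right_le.
suff : t * b < - a by lra.
by near: t; apply: near0_mul_lt; rewrite oppr_gt0.
Unshelve. all: by end_near. Qed.

Lemma mx_continuous (R : realType) (T : topologicalType) m n
    (f : T -> 'M[R]_(m, n)) :
  (forall i j, continuous (fun x => f x i j)) -> continuous f.
Proof.
move=> fc x; apply/cvg_ballP => e e0.
have : \forall y \near x, forall i j, ball (f x i j) e (f y i j).
  apply: filter_forall => i; apply: filter_forall => j.
  by have /cvg_ballP := fc i j x; apply.
by apply: filterS => y h; split.
Qed.

Lemma continuous_mulf (R : realType) (T : topologicalType) (f g : T -> R) :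
  continuous f -> continuous g -> continuous (fun x => f x * g x).
Proof. by move=> cf cg x; exact: (cvgM (cf x) (cg x)). Qed.

Lemma sum_continuous (R : realType) (T : topologicalType) (I : finType)
    (f : I -> T -> R) :
  (forall i, continuous (f i)) -> continuous (fun x => \sum_i f i x).
Proof. by move=> fc; apply: continuous_big => //; exact: add_continuous. Qed.

Lemma qform_continuous (R : realType) n (M : 'M[R]_n) : continuous (qform M).
Proof.
rewrite (_ : qform M = fun x => \sum_i \sum_j x i 0 * M i j * x j 0); last first.
  by apply/funext => x; rewrite qformE.
apply: sum_continuous => i; apply: sum_continuous => j.
apply: continuous_mulf; last exact: coord_continuous.
by apply: continuous_mulf; [exact: coord_continuous|exact: cst_continuous].
Qed.

Lemma closed_bounded_min (R : realType) n (A : set 'cV[R]_n)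
    (f : 'cV[R]_n -> R) (C : R) :
  A !=set0 -> closed A -> (forall x, A x -> forall i, `|x i 0| <= C) ->
  continuous f ->
  exists2 x, A x & forall y, A y -> f x <= f y.
Proof.
move=> [a Aa] cA bA cf.
have ctr : continuous (@trmx R 1 n).
  apply: mx_continuous => i j x.
  rewrite (_ : (fun y : 'rV_n => y^T i j) = fun y : 'rV_n => y j i); last first.
    by apply/funext => y; rewrite mxE.
  exact: coord_continuous.
have [] := @EVT_min_rV R n (f \o trmx) (trmx @^-1` A).
- by exists a^T => /=; rewrite trmxK.
- apply: bounded_closed_compact; last by move/continuous_closedP : ctr; exact.
  exists (`|C|); split; first exact: num_real.
  move=> D CD x Ax /=; rewrite [`|x|]mx_normrE; apply: bigmax_le => [|[i j] _ /=].
    by rewrite (le_trans _ (ltW CD)).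
  have := bA _ Ax j; rewrite (ord1 i) mxE => /le_trans; apply.
  by rewrite (le_trans (ler_norm _))// ltW.
- apply: continuous_subspaceT => x; apply: continuous_comp; [exact: ctr|exact: cf].
move=> x; rewrite inE => Ax xm; exists x^T => // y Ay.
by have := xm y^T; rewrite inE/= trmxK; apply.
Qed.

(** * Gordan's theorem of the alternative *)

(** Let [p] be the point of least norm in the convex hull of the rows of [A]. By
    minimality every row has a scalar product at least [|p|^2] with [p]; hence
    [p] itself is the required [y], unless it vanishes. *)
Lemma gordan (R : realType) m d (A : 'M[R]_(m, d)) :
  (exists y : 'cV[R]_d, forall i, 0 < (A *m y) i 0) \/
  (exists w : 'cV[R]_m, [/\ forall i, 0 <= w i 0, \sum_i w i 0 = 1 &
     A^T *m w = 0]).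
Proof.
case: m A => [|m] A; first by left; exists 0 => -[].
pose S : set 'cV[R]_m.+1 := [set w | (forall i, 0 <= w i 0) /\ \sum_i w i 0 = 1].
pose sq : 'cV[R]_d -> R := qform 1%:M.
have [] := @closed_bounded_min R m.+1 S (fun w => sq (A^T *m w)) 1.
- exists (delta_mx 0 0); split => [i|]; first by rewrite mxE ler0n.
  rewrite (bigD1 0)//= big1 ?addr0 => [|i /negbTE i0]; first by rewrite mxE !eqxx.
  by rewrite mxE i0.
- rewrite (_ : S = (\bigcap_i (fun w : 'cV[R]_m.+1 => w i 0) @^-1` [set x | 0 <= x]) `&`
      ((fun w : 'cV[R]_m.+1 => \sum_i w i 0) @^-1` [set x | x = 1])); last first.
    apply/seteqP; split => w [w0 w1]; split => // i; first by move=> _; exact: w0.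
    exact: w0.
  apply: closedI.
    apply: closed_bigI => i _; apply: preimage_closed; last exact: closed_ge.
    by move=> ? _; exact: coord_continuous.
  apply: preimage_closed; last exact: closed_eq.
  by move=> x _; apply: sum_continuous => i; exact: coord_continuous.
- move=> w [w0 w1] i; rewrite ger0_norm// -w1 (bigD1 i)//= lerDl.
  by rewrite sumr_ge0.
- move=> w; apply: (@continuous_comp _ _ _ (mulmx A^T) sq); last exact: qform_continuous.
  apply: mx_continuous => i j.
  rewrite (_ : (fun w => _) = fun w : 'cV[R]_m.+1 => \sum_k A^T i k * w k j).
    apply: sum_continuous => k.
    by apply: continuous_mulf; [exact: cst_continuous|exact: coord_continuous].
  by apply/funext => ?; rewrite mxE.
move=> w [w0 w1] wmin.
set p := A^T *m w in wmin.
have pmin i : sq p <= (A *m p) i 0.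
  pose v := col i A^T - p.
  suff : 0 <= 2 * ((A *m p) i 0 - sq p) by lra.
  (* Compare p with the points of the segment from p to the i-th row. *)
  apply: (@ge0_of_perturbed _ _ (sq v)) => t /andP[t0 t1].
  have := wmin ((1 - t) *: w + t *: delta_mx i 0).
  rewrite mulmxDr -!scalemxAr -colE -/p.
  rewrite (_ : _ *: _ + _ = p + t *: v); last first.
    by rewrite /v scalerBr scalerBl scale1r addrA addrAC.
  rewrite /sq qformD ?symmetric_trmx ?trmx1// qformZ.
  rewrite (_ : ((t *: v)^T *m _) 0 0 = t * ((A *m p) i 0 - qform 1%:M p)); last first.
    rewrite (_ : (t *: v)^T = t *: (row i A - p^T)); last first.
      by apply/rowP => j; rewrite !mxE.
    rewrite /qform mul1mx mulmx1 -scalemxAl mulmxBl -row_mul.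
    rewrite [LHS]mxE; congr (t * _); rewrite [LHS]mxE.
    by congr (_ + _); rewrite [LHS]mxE.
  rewrite -/(sq _) -/(sq _) => h.
  have : 0 <= t * (2 * ((A *m p) i 0 - sq p) + t * sq v).
    suff /h : S ((1 - t) *: w + t *: delta_mx i 0) by lra.
    split=> [k|].
      by rewrite !mxE addr_ge0// mulr_ge0 ?ler0n ?subr_ge0// ltW.
    rewrite (eq_bigr (fun k => (1 - t) * w k 0 + t * (k == i)%:R)); last first.
      by move=> k _; rewrite !mxE andbT.
    rewrite big_split/= -!mulr_sumr w1 (bigD1 i)//= eqxx big1 ?addr0.
      by rewrite !mulr1 subrK.
    by move=> k /negbTE ->.
  by rewrite pmulr_rge0.
have [p0|p0] := eqVneq p 0; first by right; exists w.
left; exists p => i; apply: lt_le_trans (pmin i).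
have sq0 (j : 'I_d) : true -> 0 <= p j 0 ^+ 2 by move=> _; rewrite sqr_ge0.
rewrite /sq qform1 lt_neqAle sumr_ge0// andbT eq_sym; apply: contra p0.
rewrite psumr_eq0// => /allP p0; apply/eqP/colP => j; rewrite [RHS]mxE.
by have := p0 j; rewrite mem_index_enum sqrf_eq0 => /(_ isT) /eqP.
Qed.

Lemma gordan_fin (R : realType) (I J : finType) (a : I -> J -> R) :
  (exists y : J -> R, forall i, 0 < \sum_j a i j * y j) \/
  (exists w : I -> R, [/\ forall i, 0 <= w i, \sum_i w i = 1 &
     forall j, \sum_i w i * a i j = 0]).
Proof.
pose A : 'M[R]_(#|I|, #|J|) := \matrix_(i, j) a (enum_val i) (enum_val j).
have sumE (T : finType) (F : 'I_#|T| -> R) : \sum_i F i = \sum_t F (enum_rank t).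
  by rewrite (reindex enum_rank)//; exact/onW_bij/enum_rank_bij.
have [[y yP]|[w [w0 w1 wA]]] := gordan A.
  left; exists (fun j => y (enum_rank j) 0) => i.
  have := yP (enum_rank i); rewrite mxE sumE.
  by under eq_bigr do rewrite mxE !enum_rankK.
right; exists (fun i => w (enum_rank i) 0); split => //.
  by rewrite -(sumE _ (fun i => w i 0)).
move=> j; move/colP/(_ (enum_rank j)) : wA; rewrite !mxE sumE => {}wA.
rewrite -[RHS]wA.
by apply: eq_bigr => i _; rewrite !mxE !enum_rankK mulrC.
Qed.

(** * Branches of the hyperbola *)

(** The components of the hyperbola, indexed by a finite type so that finitely
    many conditions survive a small perturbation simultaneously. *)
Definition signed_branch (R : realType) n (s : {ffun 'I_n -> bool}) :
    set 'cV[R]_n :=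
  [set x | hyperbola R n x /\ forall i, 0 < (-1) ^+ s i * x i 0].
Arguments signed_branch R {n} s.

Lemma hyperbola_neq0 (R : realType) n (x : 'cV[R]_n) i :
  hyperbola R n x -> x i 0 != 0.
Proof.
rewrite /hyperbola /= => Hx; apply/eqP => xi0; move: Hx.
by rewrite (bigD1 i)//= xi0 mul0r normr0 => /esym/eqP; rewrite oner_eq0.
Qed.

(** A connected part of the hyperbola cannot leave an orthant, because no
    coordinate vanishes on it. Conversely, inside an orthant the hyperbola is a
    hyperplane in logarithmic coordinates, and [g] below is a segment there. *)
Lemma component_hyperbola (R : realType) n (x : 'cV[R]_n) : hyperbola R n x ->
  connected_component (hyperbola R n) x =
    [set y | hyperbola R n y /\ forall i, 0 < x i 0 * y i 0].
Proof.
move=> Hx; apply/seteqP; split => y /=.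
  move=> [C [Cx CH cC] Cy]; split=> [|i]; first exact: CH.
  rewrite ltNge; apply/negP => xy.
  have : connected ((fun z : 'cV[R]_n => z i 0) @` C).
    apply: connected_continuous_connected => //; apply: continuous_subspaceT.
    by move=> ?; exact: coord_continuous.
  rewrite connected_intervalP => iC.
  suff [z Cz z0] : ((fun z : 'cV[R]_n => z i 0) @` C) 0.
    by have := hyperbola_neq0 i (CH _ Cz); rewrite z0 eqxx.
  have [x0|x0] := leP (x i 0) 0.
    have [x00|x00] := eqVneq (x i 0) 0; first by exists x.
    apply: (iC (x i 0) (y i 0)); [by exists x|by exists y|].
    by rewrite x0/=; move: x00 x0 xy; rewrite neq_lt; nra.
  apply: (iC (y i 0) (x i 0)); [by exists y|by exists x|].
  rewrite (ltW x0) andbT; nra.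
move=> [Hy xy].
pose l i := ln (y i 0 / x i 0).
have yx i : 0 < y i 0 / x i 0.
  have := xy i; have := hyperbola_neq0 i Hx => xi0.
  rewrite (_ : y i 0 / x i 0 = x i 0 * y i 0 / x i 0 ^+ 2); last by field.
  by rewrite divr_gt0// exprn_even_gt0.
have l0 : \sum_i l i = 0.
  apply: expR_inj; rewrite expR0 expR_sum.
  rewrite (eq_bigr (fun i => `|y i 0| / `|x i 0|)); last first.
    by move=> i _; rewrite lnK ?posrE// -normfV -normrM gtr0_norm.
  by rewrite big_split/= prodfV -!normr_prod Hx Hy invr1 mulr1.
pose g (t : R) : 'cV[R]_n := \col_i (x i 0 * expR (t * l i)).
have gc : continuous g.
  apply: mx_continuous => i j.
  rewrite (_ : (fun t => _) = fun t => x i 0 * expR (t * l i)); last first.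
    by apply/funext => t; rewrite mxE.
  apply: continuous_mulf; first exact: cst_continuous.
  move=> t; apply: continuous_comp; last exact: continuous_expR.
  exact: mulrr_continuous.
exists (g @` `[0, 1]); last first.
  exists 1; first by rewrite /= in_itv/= lexx ler01.
  apply/colP => i; rewrite mxE mul1r lnK ?posrE//.
  by rewrite mulrCA mulfV ?mulr1// hyperbola_neq0.
split.
- exists 0; first by rewrite /= in_itv/= lexx ler01.
  by apply/colP => i; rewrite mxE mul0r expR0 mulr1.
- move=> _ [t _ <-]; rewrite /hyperbola /=.
  under eq_bigr do rewrite mxE.
  by rewrite big_split/= -expR_sum -mulr_sumr l0 mulr0 expR0 mulr1.
- apply: connected_continuous_connected; first exact: segment_connected.
  exact: continuous_subspaceT.
Qed.

Lemma branches_signed (R : realType) n B : branches R n B ->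
  exists s, B = signed_branch R s.
Proof.
move=> [x Hx <-]; exists [ffun i => x i 0 < 0]; rewrite component_hyperbola//.
apply/seteqP; split => y [Hy xy]; split => // i; have := xy i;
  rewrite ffunE; have := hyperbola_neq0 i Hx;
  case: (ltgtP (x i 0) 0) => // x0 _; rewrite ?expr1 ?expr0 ?mulN1r ?mul1r ?oppr_gt0
    ?(nmulr_rgt0 _ x0) ?(pmulr_rgt0 _ x0)//.
Qed.

Lemma signed_branch_signs (R : realType) n (s : {ffun 'I_n -> bool}) :
  signed_branch R s (\col_i (-1) ^+ s i).
Proof.
split=> [|i].
  rewrite /hyperbola /= normr_prod big1// => i _.
  by rewrite mxE normrX normrN1 expr1n.
by rewrite mxE -expr2 sqrr_sign.
Qed.

Lemma signed_branches (R : realType) n (s : {ffun 'I_n -> bool}) :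
  branches R n (signed_branch R s).
Proof.
have [Hs _] := signed_branch_signs R s.
exists (\col_i (-1) ^+ s i) => //; rewrite component_hyperbola//.
by apply/seteqP; split => y [Hy xy]; split => // i; have := xy i; rewrite mxE.
Qed.

(** A one-parameter family of motions of each branch, by which both the
    unboundedness of quadratic forms and the stationarity conditions are
    obtained without tangent spaces. *)
Definition rescale (R : realType) n (i j : 'I_n) (c : R) (x : 'cV[R]_n) :
    'cV[R]_n :=
  \col_k (x k 0 * if k == i then c else if k == j then c^-1 else 1).

Lemma signed_branch_rescale (R : realType) n (s : {ffun 'I_n -> bool}) i j c
    (x : 'cV[R]_n) : i != j -> 0 < c ->
  signed_branch R s x -> signed_branch R s (rescale i j c x).
Proof.
move=> ij c0 [Hx sx]; split=> [|k]; last first.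
  by rewrite mxE mulrA mulr_gt0//; case: ifP => // _; case: ifP; rewrite ?invr_gt0.
rewrite /hyperbola /= -[RHS]Hx; congr (`|_|).
under eq_bigr do rewrite mxE; rewrite big_split/= -[RHS]mulr1; congr (_ * _).
rewrite (bigD1 i)//= eqxx (bigD1 j)/=; last by rewrite eq_sym.
rewrite eq_sym (negbTE ij) eqxx big1 ?mulr1 ?divff ?gt_eqF//.
by move=> k /andP[/negbTE -> /negbTE ->].
Qed.

(** The strict sign conditions may be relaxed to weak ones, which are closed,
    since coordinates do not vanish on the hyperbola. *)
Lemma closed_signed_branch (R : realType) n (s : {ffun 'I_n -> bool}) :
  closed (signed_branch R s).
Proof.
rewrite (_ : signed_branch R s =
    (fun x : 'cV[R]_n => `|\prod_i x i 0|) @^-1` [set r | r = 1] `&`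
    \bigcap_i (fun x : 'cV[R]_n => (-1) ^+ s i * x i 0) @^-1` [set r | 0 <= r]).
  apply: closedI.
    apply: preimage_closed; last exact: closed_eq.
    move=> x _; apply: continuous_comp; last exact: norm_continuous.
    apply: continuous_big => //; first exact: mul_continuous.
    by move=> i _; exact: coord_continuous.
  apply: closed_bigI => i _; apply: preimage_closed; last exact: closed_ge.
  move=> x _; apply: continuous_mulf; first exact: cst_continuous.
  exact: coord_continuous.
apply/seteqP; split => x [Hx sx]; split => //= i; first by move=> _; exact: ltW.
by have := sx i I; rewrite /= le_eqVlt eq_sym mulf_eq0 signr_eq0/=
  (negbTE (hyperbola_neq0 i Hx)).
Qed.

(** * Quadratic forms on a branch *)

(** The branch is connected, and on it the form takes a value at most [n], at
    [x], and a value at least [n], far away. The hypothesis [1 < n] makes the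
    branch unbounded. *)
Lemma ellipsoid_meets (R : realType) n (M : 'M[R]_n) K s x :
  (1 < n)%N -> 0 < K -> coercive K M ->
  signed_branch R s x -> qform M x <= n%:R ->
  ellipsoid M `&` signed_branch R s !=set0.
Proof.
move=> n1 K0 cM sx qx.
have n0 := ltnW n1.
pose i := Ordinal n0; pose j := Ordinal n1.
have ij : i != j by [].
pose a := x i 0 ^+ 2.
have a0 : 0 < a by rewrite exprn_even_gt0// hyperbola_neq0//; case: sx.
(* By coercivity the value at the rescaled point is at least a c^2 / K, and
   a c^2 / K >= a c / K >= n. *)
pose c := 1 + K * n%:R / a.
have c1 : 1 <= c.
  by rewrite /c lerDl; apply: divr_ge0; [apply: mulr_ge0; [exact: ltW|]|exact: ltW].
have c0 : 0 < c := lt_le_trans ltr01 c1.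
have sy := signed_branch_rescale ij c0 sx.
set y := rescale i j c x in sy.
have qy : n%:R <= qform M y.
  have := cM y i; rewrite mxE eqxx exprMn -/a => h.
  rewrite -(ler_pM2l K0); apply: le_trans h.
  apply: (@le_trans _ _ (a * c)); last by rewrite ler_pM2l// expr2 ler_peMr// ltW.
  by rewrite /c mulrDr mulr1 mulrCA mulfV ?gt_eqF// mulr1 lerDr ltW.
have [b Hb sb] := signed_branches R s.
have : connected (qform M @` signed_branch R s).
  apply: connected_continuous_connected.
    by rewrite -sb; exact: component_connected.
  exact/continuous_subspaceT/qform_continuous.
rewrite connected_intervalP => qI.
have [|z sz qz] := qI _ _ (imageP _ sx) (imageP _ sy) n%:R; last first.
  by exists z; split; [exact: qz|exact: sz].
by rewrite qx qy.
Qed.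

Lemma branch_min (R : realType) n (M : 'M[R]_n) K s :
  0 < K -> coercive K M -> exists2 x, signed_branch R s x &
    forall y, signed_branch R s y -> qform M x <= qform M y.
Proof.
move=> K0 cM.
have s0 := signed_branch_signs R s.
set x0 := \col_i _ in s0.
have [||||x [sx qx] xmin] := @closed_bounded_min R n
    (signed_branch R s `&` qform M @^-1` [set r | r <= qform M x0])
    (qform M) (1 + K * qform M x0).
- by exists x0; split => //=.
- apply: closedI; first exact: closed_signed_branch.
  by apply: preimage_closed; [move=> ? _; exact: qform_continuous|exact: closed_le].
- move=> x [_ /= qx] i.
  have : `|x i 0| ^+ 2 <= K * qform M x0.
    by rewrite real_normK ?num_real// (le_trans (cM x i))// ler_pM2l.
  (* Here u ^ 2 <= B implies u <= 1 + B. *)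
  by have := normr_ge0 (x i 0); nra.
- exact: qform_continuous.
exists x => // y sy; have [yx|/ltW xy] := leP (qform M y) (qform M x0).
  exact: xmin.
exact: le_trans qx xy.
Qed.

(** Lagrange's condition [x_i (M x)_i = const] for the constraint
    [prod x_i = const]. The motion [rescale i j (1 + t)] changes the form by
    [2 t (g i - g j) + O(t^2)], where [g i = x_i (M x)_i], so minimality gives
    [g j <= g i], and the roles of [i] and [j] may be exchanged. *)
Lemma branch_min_stationary (R : realType) n (M : 'M[R]_n) s x :
  M \is symmetricmx -> signed_branch R s x ->
  (forall y, signed_branch R s y -> qform M x <= qform M y) ->
  forall i j, x i 0 * (M *m x) i 0 = x j 0 * (M *m x) j 0.
Proof.
move=> sM sx xmin.
pose g i := x i 0 * (M *m x) i 0; rewrite -/(g _).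
suff gle i j : i != j -> g j <= g i.
  move=> i j; have [->//|ij] := eqVneq i j.
  by apply/eqP; rewrite eq_le !gle// eq_sym.
move=> ij; rewrite -subr_ge0.
pose C := (`|x i 0| + `|x j 0|) ^+ 2.
pose S := \sum_i \sum_j `|M i j|.
suff : 0 <= 2 * (g i - g j) by lra.
apply: (@ge0_of_perturbed _ _ (2 * `|g j| + S * C)) => t /andP[t0 t1].
have t10 : 0 < 1 + t by rewrite addr_gt0.
pose u : 'cV[R]_n := \col_k
  (if k == i then x i 0 else if k == j then - x j 0 / (1 + t) else 0).
have xE : rescale i j (1 + t) x = x + t *: u.
  apply/colP => k; rewrite !mxE.
  case: eqVneq => [->|_]; first by ring.
  case: eqVneq => [->|_]; last by ring.
  by field; rewrite gt_eqF.
have := xmin _ (signed_branch_rescale ij t10 sx).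
rewrite xE qformD// qformZ.
have -> : ((t *: u)^T *m (M *m x)) 0 0 = t * (g i - g j / (1 + t)).
  have uE k : (t *: u)^T 0 k = t * (if k == i then x i 0 else
      if k == j then - x j 0 / (1 + t) else 0) by rewrite !mxE.
  rewrite mxE (bigD1 i)//= (bigD1 j)/=; last by rewrite eq_sym.
  rewrite big1 => [|k /andP[ki kj]]; last first.
    by rewrite uE (negbTE ki) (negbTE kj) mulr0 mul0r.
  rewrite addr0 !uE eqxx eq_sym (negbTE ij) eqxx /g.
  by field; rewrite gt_eqF.
have : `|qform M u| <= S * C.
  apply: qform_bound => k; rewrite mxE.
  have xi := normr_ge0 (x i 0); have xj := normr_ge0 (x j 0).
  rewrite -real_normK ?num_real// ler_sqr ?nnegrE ?addr_ge0//.
  case: ifP => _; first by rewrite lerDl.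
  case: ifP => _; last by rewrite normr0 addr_ge0.
  rewrite normrM normrN normfV (gtr0_norm t10) ler_pdivrMr//.
  nra.
rewrite ler_norml => /andP[_ qu] h.
have {}h : 0 <= 2 * (g i - g j / (1 + t)) + t * qform M u.
  by rewrite -(pmulr_rge0 _ t0); lra.
have gj : g j - g j / (1 + t) <= t * `|g j|.
  have -> : g j - g j / (1 + t) = t * (g j / (1 + t)).
    by field; rewrite gt_eqF.
  rewrite ler_pM2l// ler_pdivrMr// mulrDr mulr1.
  by rewrite (le_trans (ler_norm _))// lerDl mulr_ge0// ltW.
have : t * qform M u <= t * (S * C) by rewrite ler_pM2l.
lra.
Qed.

(** * Local extremality *)

(** Coercivity bounds [|q_N|] by a multiple of [q_M], and for the given [t] the
    perturbation is at most half of [q_M]. *)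
Lemma perturbed_coercive (R : realType) n (M N : 'M[R]_n) K t :
  0 < K -> psd M -> coercive K M -> N \is symmetricmx ->
  0 <= t -> t * ((\sum_i \sum_j `|N i j|) * K) <= 1 / 2 ->
  psd (M + t *: N) /\ coercive (2 * K) (M + t *: N).
Proof.
move=> K0 [sM pM] cM sN t0 tS.
have qle x : qform M x <= 2 * qform (M + t *: N) x.
  rewrite qformDZ.
  have := qform_bound N (cM x); rewrite ler_norml => /andP[+ _].
  move=> /(ler_wpM2l t0); have := pM x; rewrite -/(qform M x) => q0 h.
  have := ler_wpM2r q0 tS; lra.
split; last first.
  move=> x i; apply: le_trans (cM x i) _.
  by rewrite (mulrC 2) -mulrA ler_pM2l.
split=> [|x].
  move: sM sN; rewrite !symmetric_trmx => /eqP sM /eqP sN.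
  by apply/eqP/matrixP => i j; rewrite {1}sM {1}sN !mxE.
by have := qle x; have := pM x; rewrite -!/(qform _ _); lra.
Qed.

(** Otherwise [M + t N] would be admissible for small [t > 0]: on each branch the
    form stays at most [n] at the given point, which suffices by
    [ellipsoid_meets]; but its diagonal entry exceeds that of [M]. *)
Lemma no_improving_direction (R : realType) n (M N : 'M[R]_n) lambda mu :
  (1 < n)%N -> psd M -> M \in unitmx -> locally_extremal M lambda ->
  N \is symmetricmx -> const_diag N mu -> 0 < mu ->
  ~ (forall s, exists2 x, signed_branch R s x &
       qform M x < n%:R \/ qform M x = n%:R /\ qform N x < 0).
Proof.
move=> n1 pM uM [dM _ extM] sN dN mu0 imp.
have [K K0 cM] := psd_coercive pM uM.
have Mt_cvg : (M + t *: N) @[t --> (0 : R)^'+] --> M.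
  apply: cvg_at_right_filter; rewrite -[X in _ --> X]addr0 -(scale0r N).
  by apply: cvgD; [exact: cvg_cst|apply: cvgZr_tmp; exact: cvg_id].
have low s : \forall t \near (0 : R)^'+,
    exists2 x, signed_branch R s x & qform (M + t *: N) x <= n%:R.
  have [x sx [qx|[qx qN]]] := imp s.
    near=> t; exists x => //; rewrite qformDZ.
    suff : t * qform N x < n%:R - qform M x by lra.
    by near: t; apply: near0_mul_lt; rewrite subr_gt0.
  near=> t; exists x => //; rewrite qformDZ qx gerDl.
  by rewrite nmulr_lle0.
near (0 : R)^'+ => t.
have t0 : 0 < t by [].
have [|pMN cMN] := @perturbed_coercive R n M N K t K0 pM cM sN (ltW t0).
  by apply/ltW; near: t; exact: near0_mul_lt.
have dMN : const_diag (M + t *: N) (lambda + t * mu).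
  by move=> i; rewrite !mxE dM dN.
suff : admissible (M + t *: N).
  have : admissible (M + t *: N) ->
      forall mu0, const_diag (M + t *: N) mu0 -> mu0 <= lambda.
    by near: t; exact: Mt_cvg extM.
  by move=> /[apply] /(_ _ dMN); rewrite gerDl leNgt mulr_gt0.
split=> //; first by exists (lambda + t * mu).
move=> B /branches_signed[s ->].
have [x sx qx] : exists2 x, signed_branch R s x & qform (M + t *: N) x <= n%:R.
  by move: s {B}; near: t; exact: filter_forall.
by apply: ellipsoid_meets cMN sx qx => //; rewrite mulr_gt0.
Unshelve. all: by end_near. Qed.

(** * The bound on the diagonal *)

Lemma hyperbola_AGM (R : realType) n (x : 'cV[R]_n) : (0 < n)%N ->
  hyperbola R n x -> n%:R <= \sum_i x i 0 ^+ 2 ?= iff [forall i, x i 0 ^+ 2 == 1].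
Proof.
move=> n0 Hx.
have px : \prod_i x i 0 ^+ 2 = 1.
  by rewrite prodrXl -real_normK ?num_real// Hx expr1n.
have n0' : 0 < n%:R :> R by rewrite ltr0n.
have := @leif_AGM R _ predT (fun i : 'I_n => x i 0 ^+ 2) (fun i _ => sqr_ge0 _).
rewrite cardT size_enum_ord px => -[le1 eq1].
set S := \sum_i _ in le1 eq1 *.
have S0 : 0 <= S / n%:R.
  by rewrite divr_ge0// sumr_ge0// => i _; rewrite sqr_ge0.
split.
  rewrite -[n%:R]mul1r -ler_pdivlMr// leNgt; apply/negP => S1.
  by move: le1; rewrite leNgt exprn_ilt1// -lt0n n0.
apply/idP/forallP => [|x1].
  move=> /eqP nS i; move: eq1; rewrite -nS divff ?lt0r_neq0// expr1n eqxx.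
  move=> /esym/forall_inP allE.
  have : (x i 0 ^+ 2) ^+ n == 1.
    rewrite -px -[X in _ ^+ X]card_ord -prodr_const; apply/eqP.
    by apply: eq_bigr => j _; have /forall_inP/(_ j isT)/eqP := allE i isT.
  by rewrite pexpr_eq1 ?sqr_ge0// -?lt0n.
by rewrite /S (eq_bigr (fun=> 1)) ?sumr_const ?card_ord// => i _; apply/eqP.
Qed.

(** The hypotheses say that [D = sum_k w_k x_k x_k^T] is diagonal and that [x_k]
    and [M x_k] are entrywise inverse to each other. Everything follows by
    computing [M D] entrywise: [lambda D_ii = sum_k w_k = 1], while
    [tr D >= n]. *)
Lemma diag_le1_of_weights (R : realType) n (I : finType) (M : 'M[R]_n) lambda
    (x : I -> 'cV[R]_n) (w : I -> R) :
  (0 < n)%N -> const_diag M lambda ->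
  (forall k, hyperbola R n (x k)) ->
  (forall k i, x k i 0 * (M *m x k) i 0 = 1) ->
  (forall k, 0 <= w k) -> \sum_k w k = 1 ->
  (forall i j, i != j -> \sum_k w k * (x k i 0 * x k j 0) = 0) ->
  lambda <= 1 /\ (lambda = 1 -> M = 1%:M).
Proof.
move=> n0 dM Hx xMx w0 w1 offd.
pose D i := \sum_k w k * x k i 0 ^+ 2.
have MD i j : M i j * D j = \sum_k w k * ((M *m x k) i 0 * x k j 0).
  rewrite [RHS](eq_bigr (fun k => \sum_l M i l * (w k * (x k l 0 * x k j 0)))).
    rewrite exchange_big/= (bigD1 j)//= [X in _ + X]big1 ?addr0 => [|l lj].
      by rewrite -mulr_sumr.
    by rewrite -mulr_sumr offd ?mulr0.
  move=> k _; rewrite mxE mulr_suml mulr_sumr; apply: eq_bigr => l _; ring.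
have lD i : lambda * D i = 1.
  rewrite -(dM i) MD -w1; apply: eq_bigr => k _.
  by rewrite mulrC [X in X * _]mulrC xMx mul1r.
have sD : \sum_i D i = \sum_k w k * \sum_i x k i 0 ^+ 2.
  by rewrite exchange_big/=; apply: eq_bigr => k _; rewrite mulr_sumr.
have nD : n%:R <= \sum_i D i.
  rewrite sD -[n%:R]mul1r -[X in X * _]w1 mulr_suml; apply: ler_sum => k _.
  by rewrite ler_wpM2l// (hyperbola_AGM n0 (Hx k)).
have lDn : lambda * \sum_i D i = n%:R.
  by rewrite mulr_sumr (eq_bigr (fun=> 1)) // sumr_const card_ord.
have n0' : 0 < n%:R :> R by rewrite ltr0n.
split; first by nra.
move=> l1.
have D1 i : D i = 1 by rewrite -(lD i) l1 mul1r.
have wx k : w k != 0 -> forall i, x k i 0 ^+ 2 = 1.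
  move=> wk.
  have : \sum_k w k * (\sum_i x k i 0 ^+ 2 - n%:R) = 0.
    under eq_bigr do rewrite mulrBr.
    by rewrite sumrB -sD -mulr_suml w1 mul1r -lDn l1 mul1r subrr.
  move/eqP; rewrite psumr_eq0 => [/allP/(_ k)|k' _]; last first.
    by rewrite mulr_ge0// subr_ge0 (hyperbola_AGM n0 (Hx k')).
  rewrite mem_index_enum mulf_eq0 (negbTE wk) subr_eq0 eq_sym => /(_ isT).
  by rewrite (hyperbola_AGM n0 (Hx k)) => /forallP h i; apply/eqP.
apply/matrixP => i j; rewrite mxE -[LHS]mulr1 -[X in _ * X](D1 j) MD.
rewrite (eq_bigr (fun k => w k * (x k i 0 * x k j 0))); last first.
  move=> k _; have [->|/wx xk] := eqVneq (w k) 0; first by rewrite !mul0r.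
  congr (_ * (_ * _)).
  rewrite -[LHS]mul1r -(xk i) expr2 -mulrA xMx; ring.
have [->|/offd//] := eqVneq i j; first by rewrite -(D1 j).
Qed.

(** Gordan's alternative is applied to the off-diagonal products
    [(x_s)_i (x_s)_j] of the minimal points on the active branches. A solution
    [y] of the strict inequalities yields the improving direction
    [e 1 - (Q + Q^T)], where [Q] is the off-diagonal part of [y]; the small [e]
    only serves to make the diagonal positive. *)
Lemma extremal_le1 (R : realType) n (M : 'M[R]_n) lambda :
  (1 < n)%N -> psd M -> const_diag M lambda -> locally_extremal M lambda ->
  M \in unitmx -> lambda <= 1 /\ (lambda = 1 -> M = 1%:M).
Proof.
move=> n1 pM dM extM uM.
have [sM _] := pM.
have [K K0 cM] := psd_coercive pM uM.
have /choice[x xP] : forall s, exists x, signed_branch R s x /\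
    forall y, signed_branch R s y -> qform M x <= qform M y.
  by move=> s; have [x sx xmin] := branch_min s K0 cM; exists x.
have qx s : qform M (x s) <= n%:R.
  have [_ [_ _ meets] _] := extM.
  have [z [Mz sz]] := meets _ (signed_branches R s).
  by rewrite -[n%:R]Mz; exact: (xP s).2.
pose I := {s : {ffun 'I_n -> bool} | qform M (x s) == n%:R}.
pose a (k : I) (p : 'I_n * 'I_n) :=
  if p.1 == p.2 then 0 else x (val k) p.1 0 * x (val k) p.2 0.
have [[y yP]|[w [w0 w1 wa]]] := gordan_fin a.
  exfalso.
  pose Q : 'M[R]_n := \matrix_(i, j) if i == j then 0 else y (i, j).
  have qQ (k : I) : 0 < qform Q (x (val k)).
    rewrite qformE pair_bigA/= (eq_bigr (fun p => a k p * y p)); first exact: yP.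
    by move=> [i j] _; rewrite /a mxE /=; case: eqP => _; ring.
  pose N e : 'M[R]_n := e%:M - (Q + Q^T).
  have qN e s : qform (N e) (x s) = e * qform 1%:M (x s) - 2 * qform Q (x s).
    have -> : N e = (0 + e *: 1%:M) + (-1) *: (Q + 1 *: Q^T).
      by rewrite scaleN1r scale1r add0r scalemx1.
    rewrite !qformDZ qform_trmx (_ : qform 0 _ = 0); last first.
      by rewrite /qform mulmx0 mul0mx mxE.
    ring.
  have sN e : N e \is symmetricmx.
    rewrite symmetric_trmx; apply/eqP/matrixP => i j; rewrite !mxE eq_sym; ring.
  have dN e : const_diag (N e) e.
    by move=> i; rewrite !mxE eqxx addr0 subr0.
  have : \forall e \near (0 : R)^'+, forall k : I, qform (N e) (x (val k)) < 0.
    apply: filter_forall => k; near=> e.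
    rewrite qN subr_lt0; near: e; apply: near0_mul_lt.
    by rewrite mulr_gt0.
  move=> Nneg; near (0 : R)^'+ => e.
  have e0 : 0 < e by [].
  apply: (no_improving_direction n1 pM uM extM (sN e) (dN e) e0) => s.
  exists (x s); first exact: (xP s).1.
  have := qx s; rewrite le_eqVlt => /orP[qxs|]; last by left.
  right; split; first exact/eqP.
  by have /(_ (exist _ s qxs)) : forall k : I, qform (N e) (x (val k)) < 0 by near: e.
have xMx (k : I) i : x (val k) i 0 * (M *m x (val k)) i 0 = 1.
  have [sx xmin] := xP (val k).
  have st := branch_min_stationary sM sx xmin i.
  have := eqP (valP k); rewrite qform_vec (eq_bigr _ (fun j _ => esym (st j))).
  rewrite sumr_const card_ord => /eqP.
  by rewrite eqrMn2r gtn_eqF ?(ltnW n1)//= => /eqP.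
apply: (diag_le1_of_weights (ltnW n1) dM _ xMx w0 w1).
  by move=> k; have [[]] := xP (val k).
move=> i j ij; rewrite -[RHS](wa (i, j)).
by apply: eq_bigr => k _; rewrite /a/= (negbTE ij).
Unshelve. all: by end_near. Qed.

Lemma admissible_dim1 (R : realType) (M : 'M[R]_1) : admissible M -> M = 1%:M.
Proof.
move=> [_ _ meets].
have [z [Mz [Hz _]]] := meets _ (signed_branches R [ffun=> false]).
apply/matrixP => i j; rewrite !ord1 mxE eqxx.
have : qform M z = 1 by exact: Mz.
rewrite qformE !big_ord1 => <-.
have : z 0 0 ^+ 2 = 1.
  by move: Hz; rewrite /hyperbola /= big_ord1 -real_normK ?num_real// => ->; rewrite expr1n.
by rewrite mulrAC -expr2 => ->; rewrite mul1r.
Qed.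

Lemma ellipsoid1 (R : realType) n :
  ellipsoid (1%:M : 'M[R]_n) = euclidean_sphere n (Num.sqrt n%:R).
Proof.
apply/seteqP; split => x; rewrite /ellipsoid /euclidean_sphere /= -/(qform _ _) qform1.
  by move=> ->.
move=> /(congr1 (fun r => r ^+ 2)); rewrite !sqr_sqrtr ?ler0n//.
by rewrite sumr_ge0// => i _; rewrite sqr_ge0.
Qed.

(** Evaluate at [sqrt n e_i], which lies on the sphere. *)
Lemma ellipsoid_sphere_diag (R : realType) n (M : 'M[R]_n) i : (0 < n)%N ->
  ellipsoid M = euclidean_sphere n (Num.sqrt n%:R) -> M i i = 1.
Proof.
move=> n0; rewrite -ellipsoid1 => ME.
have n0' : n%:R != 0 :> R by rewrite pnatr_eq0 -lt0n.
pose e : 'cV[R]_n := Num.sqrt n%:R *: delta_mx i 0.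
have qe (N : 'M[R]_n) : qform N e = n%:R * N i i.
  rewrite qformZ sqr_sqrtr ?ler0n//; congr (_ * _).
  by rewrite /qform trmx_delta -rowE -colE !mxE.
have : ellipsoid M e by rewrite ME; rewrite /ellipsoid /= -/(qform _ _) qe mxE eqxx mulr1.
rewrite /ellipsoid /= -/(qform _ _) qe -[RHS]mulr1; exact: mulfI.
Qed.

Theorem theorem1p24 (R : realType) (n : nat) (M : 'M[R]_n) (lambda : R)
    (hn : (0 < n)%N)
    (hpsd : psd M) (hdiag : const_diag M lambda)
    (hext : locally_extremal M lambda)
    (hreg : M \in unitmx) :
  [/\ lambda <= 1,
      lambda = 1 -> ellipsoid M = euclidean_sphere n (Num.sqrt n%:R) &
      ellipsoid M = euclidean_sphere n (Num.sqrt n%:R) <-> M = 1%:M].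
Proof.
have [le1 eq1] : lambda <= 1 /\ (lambda = 1 -> M = 1%:M).
  case: n => [//|[|n]] in M hn hpsd hdiag hext hreg *.
    have [_ /admissible_dim1 M1 _] := hext.
    by rewrite -(hdiag 0) M1 mxE eqxx.
  exact: extremal_le1.
split=> //; first by move=> /eq1 ->; exact: ellipsoid1.
split=> [ME|->]; last exact: ellipsoid1.
by apply: eq1; rewrite -(hdiag (Ordinal hn)); exact: ellipsoid_sphere_diag.
Qed.
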